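(* Let $k\geq 1$ be fixed and $p\neq 0$ real. The inequality $$\frac{2}{k+2}\left( \frac{\sin x}{x}\right) ^{kp}+\frac{k}{k+2}\left( \frac{\tan x}{x}\right) ^{p}>1$$ holds for all $x\in (0,\pi/2)$ if and only if $p>0$ or $p\leq -\dfrac{\ln (k+2)-\ln 2}{k(\ln \pi -\ln 2)}$. *)

(* Defs.v *)
From Stdlib Require Import Reals.
Open Scope R_scope.

(* Left-hand side of the inequality; bases sin x / x and tan x / x are
   positive on (0, PI/2), so the real power Rpower is the usual power. *)
Definition lhs (k p x : R) : R :=
  2 / (k + 2) * Rpower (sin x / x) (k * p)
  + k / (k + 2) * Rpower (tan x / x) p.

(* Main.v *)
(** For [p > 0] the claim is AM-GM combined with [sin^3 x > x^3 cos x].  Necessity for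
    [p < 0] comes from letting [x] tend to [PI / 2].  For sufficiency put [q = - p],
    [a = x / sin x], [b = x / tan x]; the claim [k + 2 < 2 a^(kq) + k b^q] is an equality
    at [q = 0] and its right side is convex in [q], so only the critical [q] matters.
    There the case of general [k] follows from [k = 1] by a one-variable convexity
    estimate.  The case [k = 1] reads [3 < a^q (2 + cos^q x)], with equality in the limit
    at both ends; applying l'Hopital-style sign arguments twice reduces it to the
    monotonicity of an explicit quotient [W], and that to an inequality which becomes
    algebraic once [cos x] is written as [(r^3 - 2 r) / 4]. *)

Require Import Defs.
From Stdlib Require Import Reals Lra Classical.
From Coquelicot Require Import Coquelicot.
Open Scope R_scope.

(** * Sign of a derivative near an endpoint, and convexity of [exp] *)

Lemma mvt_is_derive (f df : R -> R) (a b : R) :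
  a < b -> (forall y, a <= y <= b -> is_derive f y (df y)) ->
  exists y, f b - f a = df y * (b - a) /\ a < y < b.
Proof.
  intros hab hd. apply MVT_cor2; [exact hab|].
  intros y hy. apply is_derive_Reals. now apply hd.
Qed.

Lemma incr_of_deriv_pos (f df : R -> R) (a b : R) :
  a < b -> (forall y, a <= y <= b -> is_derive f y (df y)) ->
  (forall y, a < y < b -> 0 < df y) -> f a < f b.
Proof.
  intros hab hd hp.
  destruct (mvt_is_derive f df a b hab hd) as [y [e hy]].
  specialize (hp y hy). nra.
Qed.

(* Only a lower bound [G] with [G a = 0] is needed: the functions to which this applies
   have a limit at the endpoint but a junk value there. *)
Lemma deriv_nonpos_of_left_limit (f df G : R -> R) (a x : R) :
  a < x ->
  (forall y, a < y <= x -> is_derive f y (df y)) ->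
  (forall y, a < y <= x -> G y <= f y) ->
  continuity_pt G a -> G a = 0 -> f x <= 0 ->
  exists y, a < y < x /\ df y <= 0.
Proof.
  intros hax hd hG hc h0 hf.
  apply NNPP. intro hn.
  assert (hp : forall y, a < y < x -> 0 < df y).
  { intros y hy. apply Rnot_le_lt. intro. apply hn. now exists y. }
  (* If [df > 0] throughout, then [f m < f x <= 0], and [f] lies below [f m] to the left of [m]; but
     [f >= G > f m] close to [a]. *)
  set (m := (a + x) / 2).
  assert (hm : a < m < x) by (unfold m; lra).
  assert (h1 : f m < f x).
  { apply (incr_of_deriv_pos f df); [lra| |];
      intros; [apply hd | apply hp]; lra. }
  destruct (hc (- f m)) as [d [hd0 hd1]]; [lra|].
  set (y := a + Rmin d (m - a) / 2).
  assert (hy : a < y < m /\ y - a < d).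
  { unfold y. assert (0 < Rmin d (m - a)) by (apply Rmin_glb_lt; lra).
    pose proof (Rmin_l d (m - a)). pose proof (Rmin_r d (m - a)). lra. }
  assert (h2 : f y < f m).
  { apply (incr_of_deriv_pos f df); [lra| |];
      intros; [apply hd | apply hp]; lra. }
  assert (h3 : Rabs (G y - G a) < - f m).
  { apply (hd1 y). split.
    - split; [exact I | lra].
    - simpl. unfold Rdist. rewrite Rabs_pos_eq; lra. }
  rewrite h0 in h3. apply Rabs_def2 in h3.
  pose proof (hG y). lra.
Qed.

(** The mirror image of the preceding lemma under [y -> - y]. *)
Lemma deriv_nonneg_of_right_limit (f df G : R -> R) (x b : R) :
  x < b ->
  (forall y, x <= y < b -> is_derive f y (df y)) ->
  (forall y, x <= y < b -> G y <= f y) ->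
  continuity_pt G b -> G b = 0 -> f x <= 0 ->
  exists y, x < y < b /\ 0 <= df y.
Proof.
  intros hxb hd hG hc h0 hf.
  destruct (deriv_nonpos_of_left_limit (fun y => f (- y)) (fun y => - df (- y))
              (fun y => G (- y)) (- b) (- x)) as [y [hy h]].
  - lra.
  - intros y hy. evar_last.
    + apply (is_derive_comp f Ropp).
      * apply hd. lra.
      * auto_derive; [exact I | reflexivity].
    + unfold scal; simpl; unfold mult; simpl. lra.
  - intros y hy. apply hG. lra.
  - apply (continuity_pt_comp Ropp G).
    + apply continuity_pt_opp, continuity_pt_id.
    + now rewrite Ropp_involutive.
  - now rewrite Ropp_involutive.
  - now rewrite Ropp_involutive.
  - exists (- y). split; lra.
Qed.

(** The tangent bound [1 + u <= exp u] is applied at the barycentre [m]; the linear terms cancel in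
    the weighted sum. *)
Lemma exp_convex (t x y : R) :
  0 <= t <= 1 -> exp (t * x + (1 - t) * y) <= t * exp x + (1 - t) * exp y.
Proof.
  intros ht. set (m := t * x + (1 - t) * y).
  replace (exp x) with (exp m * exp (x - m)) by (rewrite <- exp_plus; f_equal; ring).
  replace (exp y) with (exp m * exp (y - m)) by (rewrite <- exp_plus; f_equal; ring).
  pose proof (exp_pos m). pose proof (exp_ineq1_le (x - m)). pose proof (exp_ineq1_le (y - m)).
  assert (1 <= t * exp (x - m) + (1 - t) * exp (y - m)).
  { assert (t * (1 + (x - m)) <= t * exp (x - m)) by (apply Rmult_le_compat_l; lra).
    assert ((1 - t) * (1 + (y - m)) <= (1 - t) * exp (y - m)) by (apply Rmult_le_compat_l; lra).
    unfold m in *. nra. }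
  nra.
Qed.

(** * The functions [P] and [Q] *)

Lemma sin_cos_pos (x : R) :
  0 < x < PI / 2 -> 0 < sin x /\ 0 < cos x /\ sin x < 1 /\ cos x < 1.
Proof.
  intros hx.
  assert (0 < sin x) by (apply sin_gt_0; lra).
  assert (0 < cos x) by (apply cos_gt_0; lra).
  pose proof (sin2_cos2 x) as e. unfold Rsqr in e.
  repeat split; nra.
Qed.

(** Up to division by [sin^2 x], [P] and [- Q] are the derivatives of [x / sin x] and
    [x / tan x]. *)
Definition P (x : R) : R := sin x - x * cos x.
Definition Q (x : R) : R := x - sin x * cos x.

Lemma is_derive_P (x : R) : is_derive P x (x * sin x).
Proof. unfold P. auto_derive; [exact I | ring]. Qed.

Lemma is_derive_Q (x : R) : is_derive Q x (2 * (sin x) ^ 2).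
Proof.
  unfold Q. auto_derive; [exact I|].
  pose proof (sin2_cos2 x) as e. unfold Rsqr in e. nra.
Qed.

Lemma ex_derive_P (x : R) : ex_derive (fun y => P y) x.
Proof. exists (x * sin x). apply is_derive_P. Qed.

Lemma ex_derive_Q (x : R) : ex_derive (fun y => Q y) x.
Proof. exists (2 * (sin x) ^ 2). apply is_derive_Q. Qed.

Lemma Derive_P (x : R) : Derive (fun y => P y) x = x * sin x.
Proof. apply is_derive_unique, is_derive_P. Qed.

Lemma Derive_Q (x : R) : Derive (fun y => Q y) x = 2 * (sin x) ^ 2.
Proof. apply is_derive_unique, is_derive_Q. Qed.

Lemma P_pos (x : R) : 0 < x < PI / 2 -> 0 < P x.
Proof.
  intros hx. replace 0 with (P 0) by (unfold P; rewrite sin_0; ring).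
  apply (incr_of_deriv_pos P (fun y => y * sin y)); [lra| |].
  - intros; apply is_derive_P.
  - intros y hy. destruct (sin_cos_pos y) as [h _]; [lra|]. nra.
Qed.

Lemma Q_pos (x : R) : 0 < x < PI / 2 -> 0 < Q x.
Proof.
  intros hx. replace 0 with (Q 0) by (unfold Q; rewrite sin_0; ring).
  apply (incr_of_deriv_pos Q (fun y => 2 * (sin y) ^ 2)); [lra| |].
  - intros; apply is_derive_Q.
  - intros y hy. destruct (sin_cos_pos y) as [h _]; [lra|]. nra.
Qed.

Lemma sin_lt_id (x : R) : 0 < x < PI / 2 -> sin x < x.
Proof. intros. apply sin_lt_x. lra. Qed.

(** The difference vanishes at 0 and has derivative [2 sin y (y - sin y)]. The bound controls
    [ln (2 P / Q)] near 0 in [cusa_power]. *)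
Lemma Q_lt_2P (x : R) : 0 < x < PI / 2 -> Q x < 2 * P x.
Proof.
  intros hx.
  enough (2 * P 0 - Q 0 < 2 * P x - Q x) by (unfold P, Q in *; rewrite sin_0 in *; lra).
  apply (incr_of_deriv_pos (fun y => 2 * P y - Q y) (fun y => 2 * (y * sin y) - 2 * (sin y) ^ 2)); [lra| |].
  - intros y _. apply (is_derive_minus (fun y => 2 * P y) Q).
    + apply is_derive_scal, is_derive_P.
    + apply is_derive_Q.
  - intros y hy. destruct (sin_cos_pos y) as [h _]; [lra|].
    pose proof (sin_lt_id y). nra.
Qed.

(** * The cubic inequality between [P] and [Q] *)

Lemma cube_ratio_mono (r t : R) : 0 < r -> 2 < r ^ 2 -> r < t -> r ^ 3 - 2 * r < t ^ 3 - 2 * t.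
Proof.
  intros hr hr2 hrt.
  assert (0 < (t - r) * (t ^ 2 + t * r + r ^ 2 - 2)) by (apply Rmult_lt_0_compat; nra).
  nra.
Qed.

(** The quotient [y / sin y] increases, with derivative [P / sin^2], up to its value at [PI / 2]. *)
Lemma id_div_sin_lt (x : R) : 0 < x < PI / 2 -> x / sin x < PI / 2.
Proof.
  intros hx.
  replace (PI / 2) with (PI / 2 / sin (PI / 2)) at 1 by (rewrite sin_PI2; field).
  apply (incr_of_deriv_pos (fun y => y / sin y) (fun y => P y / (sin y) ^ 2)); [lra| |].
  - intros y hy. assert (0 < sin y) by (apply sin_gt_0; lra).
    unfold P. auto_derive; [lra | field; lra].
  - intros y hy. destruct (sin_cos_pos y) as [h _]; [lra|].
    apply Rdiv_lt_0_compat; [apply P_pos; lra | nra].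
Qed.

(* With [c = cos x], the inequality says [r < Q x / P x], where [r] is the root of
   [r^3 - 2 r = 4 c]; see [PQ_cubic]. *)
Lemma acos_gt (r : R) :
  1 < r < 2 -> 2 < r ^ 2 ->
  let c := (r ^ 3 - 2 * r) / 4 in
  sqrt (1 - c ^ 2) * (r * (r ^ 2 + 2) / (r ^ 4 - 2 * r ^ 2 + 4)) < acos c.
Proof.
  intros hr hr2. cbv zeta.
  set (c := fun r => (r ^ 3 - 2 * r) / 4).
  set (phi := fun r => r * (r ^ 2 + 2) / (r ^ 4 - 2 * r ^ 2 + 4)).
  set (dphi := fun r => (- r ^ 6 - 8 * r ^ 4 + 16 * r ^ 2 + 8) / (r ^ 4 - 2 * r ^ 2 + 4) ^ 2).
  set (J := fun r => acos (c r) - sqrt (1 - c r ^ 2) * phi r).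
  set (dJ := fun r => - (3 * r ^ 2 - 2) / 4 / sqrt (1 - c r ^ 2)
     + c r * ((3 * r ^ 2 - 2) / 4) / sqrt (1 - c r ^ 2) * phi r - sqrt (1 - c r ^ 2) * dphi r).
  enough (0 < J r) by (unfold J, c, phi in *; lra).
  assert (hD : forall y, 0 < y ^ 4 - 2 * y ^ 2 + 4) by (intros y; pose proof (pow2_ge_0 (y ^ 2 - 1)); nra).
  assert (hc : forall y, r <= y < 2 -> 0 < c y < 1).
  { intros y hy. assert (2 < y ^ 2 < 4) by (split; nra).
    unfold c. replace (y ^ 3 - 2 * y) with (y * (y ^ 2 - 2)) by ring.
    split; nra. }
  assert (hs : forall y, r <= y < 2 -> 0 < 1 - c y ^ 2).
  { intros y hy. pose proof (hc y hy). nra. }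
  assert (hd : forall y, r <= y < 2 -> is_derive J y (dJ y)).
  { intros y hy. pose proof (hc y hy). pose proof (hs y hy). pose proof (hD y).
    pose proof (sqrt_lt_R0 _ H0).
    assert (d1 : is_derive (fun y => acos (c y)) y (- (3 * y ^ 2 - 2) / 4 / sqrt (1 - c y ^ 2))).
    { evar_last.
      - apply (is_derive_comp acos c).
        + assert (h5 : -1 < c y < 1) by lra.
          apply is_derive_Reals, (derive_pt_eq_1 _ _ _ (derivable_pt_acos _ h5)).
          apply derive_pt_acos.
        + unfold c. auto_derive; [exact I | reflexivity].
      - unfold scal; simpl; unfold mult; simpl. rewrite Rsqr_pow2. simpl. field. simpl in *; lra. }
    assert (d2 : is_derive (fun y => sqrt (1 - c y ^ 2)) y
        (- c y * ((3 * y ^ 2 - 2) / 4) / sqrt (1 - c y ^ 2))).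
    { evar_last.
      - apply (is_derive_comp sqrt (fun y => 1 - c y ^ 2)).
        + now apply is_derive_Reals, derivable_pt_lim_sqrt.
        + unfold c. auto_derive; [exact I | reflexivity].
      - unfold scal; simpl; unfold mult; simpl. unfold c. field.
        exact (Rgt_not_eq _ _ H2). }
    assert (d3 : is_derive phi y (dphi y)).
    { unfold phi, dphi. auto_derive; [|field]; simpl in *; lra. }
    unfold J. evar_last.
    - apply (is_derive_minus (fun y => acos (c y)) (fun y => sqrt (1 - c y ^ 2) * phi y)).
      + exact d1.
      + apply (is_derive_mult (fun y => sqrt (1 - c y ^ 2)) phi); [exact d2 | exact d3 |].
        intros; apply Rmult_comm.
    - unfold dJ, minus, plus, opp, mult; simpl. field. simpl in *; lra. }
  assert (hneg : forall y, r <= y < 2 -> dJ y < 0).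
  { intros y hy. pose proof (hs y hy) as h1. pose proof (hD y) as h2.
    pose proof (sqrt_lt_R0 _ h1) as h3. pose proof (sqrt_sqrt _ (Rlt_le _ _ h1)) as h4.
    (* Multiplication by the square root leaves a rational function of [y], whose factored form
       shows the sign for [y < 2]. *)
    assert (e : dJ y * sqrt (1 - c y ^ 2) =
       - ((4 - y ^ 2) ^ 3 * (y ^ 4 + 4) * y ^ 2 / (8 * (y ^ 4 - 2 * y ^ 2 + 4) ^ 2))).
    { transitivity (- (3 * y ^ 2 - 2) / 4 + c y * ((3 * y ^ 2 - 2) / 4) * phi y
          - (sqrt (1 - c y ^ 2) * sqrt (1 - c y ^ 2)) * dphi y).
      - unfold dJ. field. lra.
      - rewrite h4. unfold c, phi, dphi. field. simpl in *; lra. }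
    assert (0 < (4 - y ^ 2) ^ 3 * (y ^ 4 + 4) * y ^ 2 / (8 * (y ^ 4 - 2 * y ^ 2 + 4) ^ 2)).
    { apply Rdiv_lt_0_compat; [|nra].
      assert (0 < 4 - y ^ 2) by nra. assert (0 < y ^ 2) by nra.
      assert (0 < y ^ 4 + 4) by nra.
      apply Rmult_lt_0_compat; [apply Rmult_lt_0_compat|]; auto.
      now apply pow_lt. }
    nra. }
  apply Rnot_le_lt. intro hJ.
  (* At 2, where [c = 1], [acos] is not differentiable; dropping [acos >= 0] leaves a lower bound
     that vanishes there. *)
  destruct (deriv_nonneg_of_right_limit J dJ (fun y => - sqrt (1 - c y ^ 2) * phi y) r 2)
    as [y [hy h]]; auto.
  - lra.
  - intros y hy. unfold J. pose proof (acos_bound (c y)). lra.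
  - apply (continuity_pt_mult (fun y => - sqrt (1 - c y ^ 2)) phi).
    + apply (continuity_pt_opp (fun y => sqrt (1 - c y ^ 2))).
      apply (continuity_pt_comp (fun y => 1 - c y ^ 2) sqrt).
      * apply derivable_continuous_pt, ex_derive_Reals_0. unfold c. auto_derive. exact I.
      * apply continuity_pt_sqrt. unfold c. lra.
    + apply derivable_continuous_pt, ex_derive_Reals_0. unfold phi. auto_derive. lra.
  - replace (1 - c 2 ^ 2) with 0 by (unfold c; field). rewrite sqrt_0. ring.
  - pose proof (hneg y). lra.
Qed.

(** Let [r] solve [r^3 - 2 r = 4 cos x]. The rational factor in [acos_gt] is then
    [(r + cos x) / (1 + r cos x)], so that lemma says [r P < Q], and the cubic is increasing beyond
    [r]. *)
Lemma PQ_cubic (x : R) :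
  0 < x < PI / 2 -> 0 < Q x ^ 3 - 2 * Q x * P x ^ 2 - 4 * cos x * P x ^ 3.
Proof.
  intros hx. destruct (sin_cos_pos x hx) as [hs [hc [_ hc1]]].
  pose proof (P_pos x hx) as hP.
  destruct (IVT (fun r => r ^ 3 - 2 * r - 4 * cos x) 1 2) as [r [hr er]]; [reg|lra|lra|lra|].
  simpl in er.
  assert (hr2 : 2 < r ^ 2) by nra.
  assert (hr' : 1 < r < 2).
  { split; apply Rnot_le_lt; intro h.
    - nra.
    - assert (r = 2) by lra. subst r. lra. }
  assert (ec : (r ^ 3 - 2 * r) / 4 = cos x) by (simpl in *; lra).
  pose proof (acos_gt r hr' hr2) as h. cbv zeta in h. rewrite ec, acos_cos in h by lra.
  assert (es : sqrt (1 - cos x ^ 2) = sin x).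
  { pose proof (sin2_cos2 x) as e. unfold Rsqr in e.
    rewrite <- (sqrt_pow2 (sin x)) by lra. f_equal. nra. }
  rewrite es in h.
  assert (hD : 0 < r ^ 4 - 2 * r ^ 2 + 4) by (pose proof (pow2_ge_0 (r ^ 2 - 1)); nra).
  replace (r * (r ^ 2 + 2) / (r ^ 4 - 2 * r ^ 2 + 4))
    with ((r + cos x) / (1 + r * cos x)) in h by (rewrite <- ec; field; simpl in *; lra).
  assert (h1 : sin x * (r + cos x) < x * (1 + r * cos x)).
  { replace (sin x * (r + cos x))
      with (sin x * ((r + cos x) / (1 + r * cos x)) * (1 + r * cos x)) by (field; nra).
    apply Rmult_lt_compat_r; [nra | exact h]. }
  assert (h2 : r < Q x / P x).
  { apply Rmult_lt_reg_r with (P x); [exact hP|].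
    replace (Q x / P x * P x) with (Q x) by (field; lra). unfold P, Q. nra. }
  pose proof (cube_ratio_mono r (Q x / P x) ltac:(lra) hr2 h2) as h3.
  replace (Q x ^ 3 - 2 * Q x * P x ^ 2 - 4 * cos x * P x ^ 3)
    with (((Q x / P x) ^ 3 - 2 * (Q x / P x) - 4 * cos x) * P x ^ 3) by (field; lra).
  apply Rmult_lt_0_compat; [simpl in *; lra | now apply pow_lt].
Qed.

(** * The case [k = 1] at the critical exponent *)

(* Up to positive factors the derivative of [ln (2 P / Q) + (1 - q) ln cos] is
   [W - (1 - q)]. *)
Definition W (x : R) : R := x * cos x / P x - 2 * sin x * cos x / Q x.

(** The derivative of [- W] has the cubic of [PQ_cubic] as numerator over [P^2 Q^2]. *)
Lemma W_decr (x y : R) : 0 < x < y -> y < PI / 2 -> W y < W x.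
Proof.
  intros hx hy. apply Ropp_lt_cancel.
  apply (incr_of_deriv_pos (fun z => - W z) (fun z =>
    (Q z ^ 3 - 2 * Q z * P z ^ 2 - 4 * cos z * P z ^ 3) / (P z ^ 2 * Q z ^ 2))); [lra| |].
  - intros z hz. pose proof (P_pos z ltac:(lra)). pose proof (Q_pos z ltac:(lra)).
    (* [e1] and [e2] simplify the quotient-rule numerators of the two terms of [W]. *)
    assert (e1 : (cos z - z * sin z) * P z - z * cos z * (z * sin z) = - Q z).
    { unfold P, Q. transitivity (sin z * cos z - z * ((sin z)² + (cos z)²)).
      - unfold Rsqr. ring.
      - rewrite sin2_cos2. ring. }
    assert (e2 : (2 * cos z * cos z - 2 * sin z * sin z) * Q z
        - 2 * sin z * cos z * (2 * sin z ^ 2) = - 2 * (Q z + 2 * cos z * P z)).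
    { unfold P, Q. transitivity (2 * (z * ((cos z)² - (sin z)²) - sin z * cos z * ((sin z)² + (cos z)²))).
      - unfold Rsqr. ring.
      - rewrite sin2_cos2, sin2. unfold Rsqr. ring. }
    unfold W. auto_derive.
    + repeat split;
        match goal with
        | |- ex_derive (fun x => P x) _ => apply ex_derive_P
        | |- ex_derive (fun x => Q x) _ => apply ex_derive_Q
        | _ => lra
        end.
    + rewrite Derive_P, Derive_Q.
      transitivity (- (((cos z - z * sin z) * P z - z * cos z * (z * sin z)) / P z ^ 2
        - ((2 * cos z * cos z - 2 * sin z * sin z) * Q z
            - 2 * sin z * cos z * (2 * sin z ^ 2)) / Q z ^ 2)).
      * field. lra.
      * rewrite e1, e2. field. lra.
  - intros z hz. apply Rdiv_lt_0_compat; [apply PQ_cubic; lra|].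
    pose proof (P_pos z ltac:(lra)). pose proof (Q_pos z ltac:(lra)).
    apply Rmult_lt_0_compat; now apply pow_lt.
Qed.

(* The critical exponent for [k = 1], where equality holds at [x = PI / 2]. *)
Definition expo : R := ln (3 / 2) / ln (PI / 2).

Lemma ln_PI2_pos : 0 < ln (PI / 2).
Proof. rewrite <- ln_1. apply ln_increasing; [lra | exact PI2_1]. Qed.

Lemma ln_3_2_pos : 0 < ln (3 / 2).
Proof. rewrite <- ln_1. apply ln_increasing; lra. Qed.

Lemma expo_pos : 0 < expo.
Proof. apply Rdiv_lt_0_compat; [exact ln_3_2_pos | exact ln_PI2_pos]. Qed.

(** Let [F] be the logarithmic form, which tends to 0 at both ends. If [F x <= 0], then [dF] is
    nonpositive at some [xi < x] and nonnegative at some [eta > x], so [E xi <= 0 <= E eta]. As [E]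
    tends to 0 at 0, [dE <= 0] at some [al < xi], while [dE >= 0] at some [be] between [xi] and
    [eta]. Thus [W al <= 1 - q <= W be], against the decrease of [W]. *)
Lemma cusa_power (x : R) :
  0 < x < PI / 2 ->
  3 < exp (expo * (ln x - ln (sin x))) * (2 + exp (expo * ln (cos x))).
Proof.
  intros hx. pose proof expo_pos as hq. set (q := expo) in *.
  set (F := fun y => ln (2 + exp (q * ln (cos y))) - ln 3 - q * (ln (sin y) - ln y)).
  set (dF := fun y => q * (2 * cos y * P y - exp (q * ln (cos y)) * Q y)
     / (y * sin y * cos y * (2 + exp (q * ln (cos y))))).
  (* [E] has the sign of [dF]. *)
  set (E := fun y => ln (2 * cos y * P y) - ln (Q y) - q * ln (cos y)).
  set (dE := fun y => sin y / cos y * (W y - (1 - q))).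
  enough (hF : 0 < F x).
  { unfold F in hF. pose proof (exp_pos (q * ln (cos x))) as he.
    apply ln_lt_inv; [lra| apply Rmult_lt_0_compat; [apply exp_pos | lra]|].
    rewrite ln_mult, ln_exp; [lra | apply exp_pos | lra]. }
  assert (hdF : forall y, 0 < y < PI / 2 -> is_derive F y (dF y)).
  { intros y hy. destruct (sin_cos_pos y hy) as [hs [hc _]].
    pose proof (exp_pos (q * ln (cos y))).
    pose proof (sin2_cos2 y) as e. unfold Rsqr in e.
    unfold F, dF. auto_derive.
    - repeat split; lra.
    - unfold P, Q. set (z := exp (q * ln (cos y))) in *.
      replace (y - sin y * cos y) with (y * (sin y * sin y) - cos y * (sin y - y * cos y)) by nra.
      field. repeat split; lra. }
  assert (hdE : forall y, 0 < y < PI / 2 -> is_derive E y (dE y)).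
  { intros y hy. destruct (sin_cos_pos y hy) as [hs [hc _]].
    pose proof (P_pos y hy). pose proof (Q_pos y hy).
    unfold E, dE, W. auto_derive.
    - repeat split;
        match goal with
        | |- ex_derive (fun x => P x) _ => apply ex_derive_P
        | |- ex_derive (fun x => Q x) _ => apply ex_derive_Q
        | _ => solve [lra | nra]
        end.
    - rewrite Derive_P, Derive_Q.
      field. repeat split; lra. }
  assert (hden : forall y, 0 < y < PI / 2 -> 0 < y * sin y * cos y * (2 + exp (q * ln (cos y)))).
  { intros y hy. destruct (sin_cos_pos y hy) as [hs [hc _]].
    pose proof (exp_pos (q * ln (cos y))).
    repeat apply Rmult_lt_0_compat; lra. }
  assert (hE : forall y, 0 < y < PI / 2 ->
    E y = ln (2 * cos y * P y) - ln (exp (q * ln (cos y)) * Q y)).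
  { intros y hy. pose proof (Q_pos y hy). unfold E.
    rewrite (ln_mult (exp _)), ln_exp; [ring | apply exp_pos | assumption]. }
  assert (hpos : forall y, 0 < y < PI / 2 ->
    0 < 2 * cos y * P y /\ 0 < exp (q * ln (cos y)) * Q y).
  { intros y hy. destruct (sin_cos_pos y hy) as [hs [hc _]].
    pose proof (P_pos y hy). pose proof (Q_pos y hy).
    split; repeat apply Rmult_lt_0_compat; try lra. apply exp_pos. }
  assert (hdFE : forall y, 0 < y < PI / 2 ->
    dF y * (y * sin y * cos y * (2 + exp (q * ln (cos y))))
      = q * (2 * cos y * P y - exp (q * ln (cos y)) * Q y)).
  { intros y hy. pose proof (hden y hy). unfold dF, Rdiv.
    rewrite Rmult_assoc, Rinv_l, Rmult_1_r; lra. }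
  apply Rnot_le_lt. intro hF.
  (* The lower bound drops the nonnegative term [- q ln (sin y / y)], whose expression is junk at
     0. *)
  destruct (deriv_nonpos_of_left_limit F dF
    (fun y => ln (2 + exp (q * ln (cos y))) - ln 3) 0 x) as [xi [hxi hdxi]].
  - lra.
  - intros y hy. apply hdF. lra.
  - intros y hy. unfold F.
    destruct (sin_cos_pos y ltac:(lra)) as [hs _].
    pose proof (ln_increasing _ _ hs (sin_lt_id y ltac:(lra))). nra.
  - apply derivable_continuous_pt, ex_derive_Reals_0. auto_derive.
    rewrite cos_0. repeat split; [lra|]. pose proof (exp_pos (q * ln 1)). lra.
  - rewrite cos_0, ln_1, Rmult_0_r, exp_0. replace (2 + 1) with 3 by ring. ring.
  - exact hF.
  (* The lower bound drops the power of [cos], whose expression is junk at [PI / 2]; what remains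
     vanishes there by the choice of [expo]. *)
  - destruct (deriv_nonneg_of_right_limit F dF
      (fun y => ln 2 - ln 3 - q * (ln (sin y) - ln y)) x (PI / 2)) as [eta [heta hdeta]].
    + lra.
    + intros y hy. apply hdF. lra.
    + intros y hy. unfold F. pose proof (exp_pos (q * ln (cos y))).
      assert (ln 2 < ln (2 + exp (q * ln (cos y)))) by (apply ln_increasing; lra). lra.
    + apply derivable_continuous_pt, ex_derive_Reals_0. auto_derive.
      rewrite sin_PI2. repeat split; lra.
    + rewrite sin_PI2, ln_1.
      replace (q * (0 - ln (PI / 2))) with (- ln (3 / 2)).
      * rewrite ln_div by lra. ring.
      * unfold q, expo. field. pose proof ln_PI2_pos. lra.
    + exact hF.
    + assert (hExi : E xi <= 0).
      { rewrite hE by lra. destruct (hpos xi ltac:(lra)) as [h1 h2].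
        enough (ln (2 * cos xi * P xi) <= ln (exp (q * ln (cos xi)) * Q xi)) by lra.
        apply ln_le; [exact h1|].
        pose proof (hdFE xi ltac:(lra)). pose proof (hden xi ltac:(lra)). nra. }
      assert (hEeta : 0 <= E eta).
      { rewrite hE by lra. destruct (hpos eta ltac:(lra)) as [h1 h2].
        enough (ln (exp (q * ln (cos eta)) * Q eta) <= ln (2 * cos eta * P eta)) by lra.
        apply ln_le; [exact h2|].
        pose proof (hdFE eta ltac:(lra)). pose proof (hden eta ltac:(lra)). nra. }
      (* Here [Q < 2 P] gives the lower bound [(1 - q) ln cos]. *)
      destruct (deriv_nonpos_of_left_limit E dE (fun y => (1 - q) * ln (cos y)) 0 xi)
        as [al [hal hdal]].
      * lra.
      * intros y hy. apply hdE. lra.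
      * intros y hy. unfold E.
        destruct (sin_cos_pos y ltac:(lra)) as [_ [hc _]].
        pose proof (Q_pos y ltac:(lra)). pose proof (Q_lt_2P y ltac:(lra)).
        replace (2 * cos y * P y) with (cos y * (2 * P y)) by ring.
        rewrite (ln_mult (cos y)) by lra.
        pose proof (ln_increasing (Q y) (2 * P y)). lra.
      * apply derivable_continuous_pt, ex_derive_Reals_0. auto_derive.
        rewrite cos_0. repeat split; lra.
      * rewrite cos_0, ln_1. ring.
      * exact hExi.
      * destruct (mvt_is_derive E dE xi eta) as [be [e hbe]]; [lra| |].
        { intros y hy. apply hdE. lra. }
        assert (hdbe : 0 <= dE be) by nra.
        pose proof (W_decr al be ltac:(lra) ltac:(lra)).
        assert (htan : forall y, 0 < y < PI / 2 -> 0 < sin y / cos y).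
        { intros y hy. destruct (sin_cos_pos y hy) as [hs [hc _]].
          now apply Rdiv_lt_0_compat. }
        pose proof (htan al ltac:(lra)). pose proof (htan be ltac:(lra)).
        unfold dE in hdal, hdbe.
        assert (W al <= 1 - q) by (apply Rnot_lt_le; intro; nra).
        assert (1 - q <= W be) by (apply Rnot_lt_le; intro; nra).
        lra.
Qed.

(** * From [k = 1] to general [k], and beyond the critical exponent *)

(* [A^(1 - lam)] is convex in [A], hence below its chord over [1, 3/2]. *)
Lemma power_chord (lam A : R) :
  1 <= lam -> 1 < A < 3 / 2 ->
  exp (lam * ln (3 / 2)) * exp ((1 - lam) * ln A) - A
    <= (exp (lam * ln (3 / 2)) - 1) * (3 - 2 * A).
Proof.
  intros hl hA. set (t := 2 * (A - 1)). set (L := ln (3 / 2)).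
  assert (eL : exp L = 3 / 2) by (apply exp_ln; lra).
  (* Since [A = t * (3 / 2) + (1 - t)], this is concavity of [ln], read off from convexity of
     [exp]. *)
  assert (h1 : t * L <= ln A).
  { rewrite <- (ln_exp (t * L)). apply ln_le; [apply exp_pos|].
    pose proof (exp_convex t L 0 ltac:(unfold t; lra)) as h.
    rewrite exp_0, eL in h. replace (t * L + (1 - t) * 0) with (t * L) in h by ring.
    unfold t in *; lra. }
  (* The factor [1 - lam <= 0] reverses [h1]; convexity of [exp] then bounds the result by the
     chord. *)
  assert (h2 : exp ((1 - lam) * ln A) <= t * exp ((1 - lam) * L) + (1 - t)).
  { pose proof (exp_convex t ((1 - lam) * L) 0 ltac:(unfold t; lra)) as h.
    rewrite exp_0, Rmult_1_r in h. eapply Rle_trans; [|exact h].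
    destruct (Req_dec ((1 - lam) * ln A) (t * ((1 - lam) * L) + (1 - t) * 0)) as [->|hne];
      [lra|]. left. apply exp_increasing. nra. }
  assert (h3 : exp (lam * L) * exp ((1 - lam) * L) = 3 / 2).
  { rewrite <- exp_plus, <- eL. f_equal. ring. }
  pose proof (exp_pos (lam * L)) as h4.
  apply (Rmult_le_compat_l (exp (lam * L))) in h2; [|lra].
  replace (exp (lam * L) * (t * exp ((1 - lam) * L) + (1 - t)))
    with (t * (exp (lam * L) * exp ((1 - lam) * L)) + exp (lam * L) * (1 - t)) in h2 by ring.
  rewrite h3 in h2. unfold t in *. nra.
Qed.

(* Transfers [3 - 2 A < B] (case [k = 1]) to [k = 2 (Y - 1)]; both sides vanish at
   [A = 1], and [power_chord] compares their derivatives in [A]. *)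
Lemma log_power_bound (lam A : R) :
  1 <= lam -> 1 < A < 3 / 2 ->
  let X := exp (lam * ln A) in
  let Y := exp (lam * ln (3 / 2)) in
  2 * (Y - 1) * ln ((Y - X) / (Y - 1)) <= lam * ln (3 - 2 * A).
Proof.
  intros hl hA. cbv zeta. pose proof ln_3_2_pos as hL.
  set (Y := exp (lam * ln (3 / 2))).
  assert (hY : 1 < Y) by (unfold Y; rewrite <- exp_0; apply exp_increasing; nra).
  assert (hX : forall B, 1 <= B < 3 / 2 -> exp (lam * ln B) < Y).
  { intros B hB. apply exp_increasing, Rmult_lt_compat_l; [lra|].
    apply ln_increasing; lra. }
  set (f := fun B => lam * ln (3 - 2 * B)
     - 2 * (Y - 1) * (ln (Y - exp (lam * ln B)) - ln (Y - 1))).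
  set (df := fun B => 2 * lam / (B * (3 - 2 * B) * (Y - exp (lam * ln B)))
     * ((Y - 1) * exp (lam * ln B) * (3 - 2 * B) - (Y - exp (lam * ln B)) * B)).
  destruct (mvt_is_derive f df 1 A) as [B [e hB]]; [lra| |].
  { intros B hB. pose proof (hX B ltac:(lra)). unfold f, df. auto_derive.
    - repeat split; lra.
    - field. repeat split; lra. }
  assert (hdf : 0 <= df B).
  { pose proof (hX B ltac:(lra)). unfold df. apply Rmult_le_pos.
    - apply Rdiv_le_0_compat; [lra|]. repeat apply Rmult_lt_0_compat; lra.
    (* The bracket in [df] is nonnegative by [power_chord] multiplied by [B^lam]. *)
    - pose proof (power_chord lam B hl ltac:(lra)) as h. fold Y in h.
      pose proof (exp_pos (lam * ln B)) as hp.
      assert (e1 : exp (lam * ln B) * exp ((1 - lam) * ln B) = B).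
      { rewrite <- exp_plus. replace (lam * ln B + (1 - lam) * ln B) with (ln B) by ring.
        apply exp_ln. lra. }
      apply (Rmult_le_compat_l (exp (lam * ln B))) in h; [|lra].
      replace (exp (lam * ln B) * (Y * exp ((1 - lam) * ln B) - B))
        with (Y * (exp (lam * ln B) * exp ((1 - lam) * ln B)) - exp (lam * ln B) * B) in h by ring.
      rewrite e1 in h. lra. }
  assert (f1 : f 1 = 0).
  { unfold f. rewrite ln_1, Rmult_0_r, exp_0. replace (3 - 2 * 1) with 1 by ring.
    rewrite ln_1. ring. }
  pose proof (hX A ltac:(lra)).
  rewrite ln_div by lra. unfold f in *. nra.
Qed.

(** The exponent [q] with [2 (PI / 2)^(k q) = k + 2], giving equality in the limit at [PI / 2];
    [crit 1] is [expo]. *)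
Definition crit (k : R) : R := (ln (k + 2) - ln 2) / (k * (ln PI - ln 2)).

Lemma crit_pos (k : R) : 0 < k -> 0 < crit k.
Proof.
  intros hk. unfold crit. rewrite <- !ln_div by (pose proof PI_RGT_0; lra).
  apply Rdiv_lt_0_compat.
  - rewrite <- ln_1. apply ln_increasing; lra.
  - apply Rmult_lt_0_compat; [exact hk | exact ln_PI2_pos].
Qed.

(** Here [a] and [b] are the logarithms of [x / sin x] and [x / tan x]. [cusa_power] gives
    [3 - 2 A < exp (expo * b)]; raising this to the power [lam / k] and applying [log_power_bound]
    bounds [exp (crit k * b)] from below by [(k + 2 - 2 X) / k]. *)
Lemma endpoint_crit (k x : R) :
  1 <= k -> 0 < x < PI / 2 ->
  k + 2 < 2 * exp (k * crit k * (ln x - ln (sin x)))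
    + k * exp (crit k * (ln (cos x) + (ln x - ln (sin x)))).
Proof.
  intros hk hx. destruct (sin_cos_pos x hx) as [hs [hc _]].
  pose proof ln_3_2_pos as hL. pose proof ln_PI2_pos as hP. pose proof expo_pos as hq.
  pose proof (cusa_power x hx) as hcusa.
  set (a := ln x - ln (sin x)) in *. set (b := ln (cos x) + a).
  assert (ha : 0 < a < ln (PI / 2)).
  { unfold a. split.
    - pose proof (ln_increasing _ _ hs (sin_lt_id x hx)). lra.
    - rewrite <- ln_div by lra. apply ln_increasing.
      + apply Rdiv_lt_0_compat; lra.
      + now apply id_div_sin_lt. }
  (* Chosen so that [Y = (3 / 2)^lam = (k + 2) / 2], hence [2 (Y - 1) = k]; [k >= 1] makes
     [lam >= 1]. *)
  set (lam := ln ((k + 2) / 2) / ln (3 / 2)).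
  assert (elam : lam * ln (3 / 2) = ln ((k + 2) / 2)) by (unfold lam; field; lra).
  assert (hlam : 1 <= lam).
  { apply Rmult_le_reg_r with (ln (3 / 2)); [exact hL|].
    rewrite elam, Rmult_1_l. apply ln_le; lra. }
  assert (ecrit : crit k = lam / k * expo).
  { unfold crit, lam, expo. rewrite <- !ln_div by (pose proof PI_RGT_0; lra).
    field. lra. }
  assert (eY : exp (lam * ln (3 / 2)) = (k + 2) / 2).
  { rewrite elam. apply exp_ln. lra. }
  set (A := exp (expo * a)) in *.
  assert (hA : 1 < A < 3 / 2).
  { unfold A. split.
    - rewrite <- exp_0. apply exp_increasing. nra.
    - rewrite <- (exp_ln (3 / 2)) by lra. apply exp_increasing.
      replace (ln (3 / 2)) with (expo * ln (PI / 2)) by (unfold expo; field; lra). nra. }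
  pose proof (log_power_bound lam A hlam hA) as h. cbv zeta in h. rewrite eY in h.
  unfold A at 1 in h. rewrite ln_exp in h.
  replace (exp (k * crit k * a)) with (exp (lam * (expo * a)))
    by (f_equal; rewrite ecrit; field; lra).
  assert (hB : 3 - 2 * A < exp (expo * b)).
  { unfold b. rewrite Rmult_plus_distr_l, exp_plus. fold A. lra. }
  set (X := exp (lam * (expo * a))) in *.
  assert (hX : X < (k + 2) / 2).
  { rewrite <- eY. apply exp_increasing, Rmult_lt_compat_l; [lra|].
    rewrite <- (ln_exp (expo * a)). apply ln_increasing; [apply exp_pos | apply hA]. }
  assert (h1 : ln (3 - 2 * A) < expo * b).
  { rewrite <- (ln_exp (expo * b)). apply ln_increasing; lra. }
  replace (2 * ((k + 2) / 2 - 1)) with k in h by field.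
  assert (h2 : (((k + 2) / 2 - X) / ((k + 2) / 2 - 1)) < exp (crit k * b)).
  { rewrite <- (exp_ln (((k + 2) / 2 - X) / ((k + 2) / 2 - 1)))
      by (apply Rdiv_lt_0_compat; lra).
    apply exp_increasing. apply Rmult_lt_reg_l with k; [lra|].
    replace (k * (crit k * b)) with (lam * (expo * b)) by (rewrite ecrit; field; lra).
    eapply Rle_lt_trans; [exact h|]. apply Rmult_lt_compat_l; lra. }
  apply (Rmult_lt_compat_l k) in h2; [|lra].
  replace (k * (((k + 2) / 2 - X) / ((k + 2) / 2 - 1))) with (k + 2 - 2 * X) in h2
    by (field; lra).
  lra.
Qed.

(** The right side is convex in the exponent and equals [k + 2] at exponent 0. As it exceeds [k + 2]
    at [crit k = t q], it does so at [q]. *)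
Lemma crit_le (k q x : R) :
  1 <= k -> crit k <= q -> 0 < x < PI / 2 ->
  k + 2 < 2 * exp (k * q * (ln x - ln (sin x)))
    + k * exp (q * (ln (cos x) + (ln x - ln (sin x)))).
Proof.
  intros hk hq hx. pose proof (crit_pos k ltac:(lra)) as hp.
  pose proof (endpoint_crit k x hk hx) as h.
  set (a := ln x - ln (sin x)) in *. set (b := ln (cos x) + a) in *.
  set (t := crit k / q).
  assert (ht : 0 < t <= 1).
  { unfold t. split; [apply Rdiv_lt_0_compat; lra|].
    apply Rmult_le_reg_r with q; [lra|].
    unfold Rdiv. rewrite Rmult_assoc, Rinv_l; lra. }
  assert (et : crit k = t * q) by (unfold t; field; lra).
  pose proof (exp_convex t (k * q * a) 0 ltac:(lra)) as h1.
  pose proof (exp_convex t (q * b) 0 ltac:(lra)) as h2.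
  rewrite exp_0 in h1, h2.
  replace (t * (k * q * a) + (1 - t) * 0) with (k * crit k * a) in h1 by (rewrite et; ring).
  replace (t * (q * b) + (1 - t) * 0) with (crit k * b) in h2 by (rewrite et; ring).
  apply (Rmult_le_compat_l k) in h2; [|lra].
  nra.
Qed.

(** * Positive exponents [p] *)

(** The logarithmic form of [sin^3 x > x^3 cos x]. It tends to 0 at 0, and its derivative has
    numerator [N] with [N 0 = 0] and [N' = 4 sin P > 0]. *)
Lemma cube_sin_gt (x : R) :
  0 < x < PI / 2 -> 0 < 3 * ln (sin x) - 3 * ln x - ln (cos x).
Proof.
  intros hx. set (f := fun y => 3 * ln (sin y) - 3 * ln y - ln (cos y)).
  set (N := fun y => y * (1 + 2 * cos y ^ 2) - 3 * sin y * cos y).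
  assert (hN : forall y, 0 < y < PI / 2 -> 0 < N y).
  { intros y hy. replace 0 with (N 0) by (unfold N; rewrite sin_0; ring).
    apply (incr_of_deriv_pos N (fun z => 4 * sin z * P z)); [lra| |].
    - intros z hz. unfold N, P. auto_derive; [exact I|].
      pose proof (sin2_cos2 z) as e. unfold Rsqr in e. nra.
    - intros z hz. destruct (sin_cos_pos z ltac:(lra)) as [hs _].
      pose proof (P_pos z ltac:(lra)). nra. }
  apply Rnot_le_lt. intro hf.
  (* The lower bound [2 ln cos] comes from [y cos y < sin y]. *)
  destruct (deriv_nonpos_of_left_limit f (fun y => N y / (y * sin y * cos y))
    (fun y => 2 * ln (cos y)) 0 x) as [y [hy h]].
  - lra.
  - intros y hy. destruct (sin_cos_pos y ltac:(lra)) as [hs [hc _]].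
    unfold f, N. auto_derive; [repeat split; lra|].
    replace (1 + 2 * cos y ^ 2) with (3 * cos y ^ 2 + sin y ^ 2).
    + field. repeat split; lra.
    + pose proof (sin2_cos2 y) as e. unfold Rsqr in e. nra.
  - intros y hy. destruct (sin_cos_pos y ltac:(lra)) as [hs [hc _]].
    pose proof (P_pos y ltac:(lra)) as hP. unfold P in hP. unfold f.
    assert (h : ln (y * cos y) < ln (sin y)) by (apply ln_increasing; nra).
    rewrite ln_mult in h; lra.
  - apply derivable_continuous_pt, ex_derive_Reals_0. auto_derive. rewrite cos_0. lra.
  - rewrite cos_0, ln_1. ring.
  - exact hf.
  - destruct (sin_cos_pos y ltac:(lra)) as [hs [hc _]].
    assert (0 < N y / (y * sin y * cos y)); [|lra].
    apply Rdiv_lt_0_compat; [apply hN; lra|].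
    repeat apply Rmult_lt_0_compat; lra.
Qed.

Lemma lhs_exp (k p x : R) :
  0 < x < PI / 2 ->
  lhs k p x = (2 * exp (k * - p * (ln x - ln (sin x)))
    + k * exp (- p * (ln (cos x) + (ln x - ln (sin x))))) / (k + 2).
Proof.
  intros hx. destruct (sin_cos_pos x hx) as [hs [hc _]].
  unfold lhs, Rpower, tan.
  rewrite (ln_div (sin x / cos x)), !ln_div by (try apply Rdiv_lt_0_compat; lra).
  replace (k * p * (ln (sin x) - ln x)) with (k * - p * (ln x - ln (sin x))) by ring.
  replace (p * (ln (sin x) - ln (cos x) - ln x))
    with (- p * (ln (cos x) + (ln x - ln (sin x)))) by ring.
  unfold Rdiv. ring.
Qed.

Lemma lhs_gt_1 (k p x : R) :
  0 < k -> 0 < x < PI / 2 ->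
  lhs k p x > 1 <->
  k + 2 < 2 * exp (k * - p * (ln x - ln (sin x)))
    + k * exp (- p * (ln (cos x) + (ln x - ln (sin x)))).
Proof.
  intros hk hx. rewrite lhs_exp by exact hx. split; intro h.
  - apply (Rmult_lt_compat_r (k + 2)) in h; [|lra].
    unfold Rdiv in h. rewrite Rmult_assoc, Rinv_l in h; lra.
  - apply Rmult_lt_reg_r with (k + 2); [lra|].
    unfold Rdiv. rewrite Rmult_assoc, Rinv_l; lra.
Qed.

(** Weighted AM-GM, as convexity of [exp] with weights [2 / (k + 2)] and [k / (k + 2)]; the mean
    exponent is a positive multiple of the quantity in [cube_sin_gt]. *)
Lemma lhs_gt_1_of_pos (k p x : R) :
  0 < k -> 0 < p -> 0 < x < PI / 2 -> lhs k p x > 1.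
Proof.
  intros hk hp hx. apply lhs_gt_1; [exact hk | exact hx |].
  pose proof (cube_sin_gt x hx) as h.
  set (a := ln x - ln (sin x)) in *.
  set (t := 2 / (k + 2)).
  assert (ht : 0 < t < 1).
  { unfold t. split; [apply Rdiv_lt_0_compat; lra|].
    apply Rmult_lt_reg_r with (k + 2); [lra|].
    unfold Rdiv. rewrite Rmult_assoc, Rinv_l; lra. }
  assert (et : (1 - t) = k / (k + 2)) by (unfold t; field; lra).
  pose proof (exp_convex t (k * - p * a) (- p * (ln (cos x) + a)) ltac:(lra)) as h1.
  assert (h2 : 1 < exp (t * (k * - p * a) + (1 - t) * (- p * (ln (cos x) + a)))).
  { rewrite <- exp_0 at 1. apply exp_increasing. rewrite et. unfold t.
    replace (2 / (k + 2) * (k * - p * a) + k / (k + 2) * (- p * (ln (cos x) + a)))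
      with (k * p / (k + 2) * (- (3 * a + ln (cos x)))) by (field; lra).
    apply Rmult_lt_0_compat; [|unfold a; lra].
    apply Rdiv_lt_0_compat; [nra | lra]. }
  pose proof (Rlt_le_trans _ _ _ h2 h1) as h3. rewrite et in h3. unfold t in h3.
  apply (Rmult_lt_compat_r (k + 2)) in h3; [|lra].
  rewrite Rmult_1_l in h3. eapply Rlt_le_trans; [exact h3|]. right. field. lra.
Qed.

(** * Necessity and conclusion *)

(** For [q < crit k] the first term stays below [2 (PI / 2)^(k q) < k + 2], while [cos x] makes the
    second arbitrarily small near [PI / 2]. *)
Lemma exists_violation (k q : R) :
  0 < k -> 0 < q < crit k ->
  exists x, 0 < x < PI / 2 /\
    2 * exp (k * q * (ln x - ln (sin x)))
      + k * exp (q * (ln (cos x) + (ln x - ln (sin x)))) <= k + 2.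
Proof.
  intros hk hq. pose proof ln_PI2_pos as hL. pose proof PI_RGT_0 as hpi. pose proof PI2_1.
  assert (h1 : exp (k * q * ln (PI / 2)) < (k + 2) / 2).
  { rewrite <- (exp_ln ((k + 2) / 2)) by lra. apply exp_increasing.
    replace (ln ((k + 2) / 2)) with (k * crit k * ln (PI / 2)).
    - apply Rmult_lt_compat_r; [exact hL|]. apply Rmult_lt_compat_l; lra.
    - unfold crit. rewrite <- !ln_div by lra. field. lra. }
  set (d := (k + 2 - 2 * exp (k * q * ln (PI / 2))) / k).
  assert (hd : 0 < d) by (apply Rdiv_lt_0_compat; lra).
  (* With [cos x = sin e < e] and [x / sin x < PI / 2], the first bound gives [(x / tan x)^q < d];
     the bound [1 / 2] keeps [x] positive. *)
  set (e := Rmin (exp (ln d / q - ln (PI / 2))) (1 / 2)).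
  assert (he : 0 < e) by (apply Rmin_glb_lt; [apply exp_pos | lra]).
  assert (he1 : e <= exp (ln d / q - ln (PI / 2))) by apply Rmin_l.
  assert (he2 : e <= 1 / 2) by apply Rmin_r.
  exists (PI / 2 - e). set (x := PI / 2 - e).
  assert (hx : 0 < x < PI / 2) by (unfold x; lra).
  split; [exact hx|].
  destruct (sin_cos_pos x hx) as [hs [hc _]].
  assert (ha : ln x - ln (sin x) < ln (PI / 2)).
  { rewrite <- ln_div by lra. apply ln_increasing.
    - apply Rdiv_lt_0_compat; lra.
    - now apply id_div_sin_lt. }
  assert (hcx : ln (cos x) < ln d / q - ln (PI / 2)).
  { rewrite <- (ln_exp (ln d / q - ln (PI / 2))). apply ln_increasing; [exact hc|].
    unfold x. rewrite cos_shift. pose proof (sin_lt_id e). lra. }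
  assert (h2 : exp (k * q * (ln x - ln (sin x))) < exp (k * q * ln (PI / 2))).
  { apply exp_increasing, Rmult_lt_compat_l; nra. }
  assert (h3 : exp (q * (ln (cos x) + (ln x - ln (sin x)))) < d).
  { rewrite <- (exp_ln d) by exact hd. apply exp_increasing.
    replace (ln d) with (q * (ln d / q)) by (field; lra).
    apply Rmult_lt_compat_l; lra. }
  apply (Rmult_lt_compat_l k) in h3; [|lra].
  replace (k * d) with (k + 2 - 2 * exp (k * q * ln (PI / 2))) in h3
    by (unfold d; field; lra).
  lra.
Qed.

Theorem theorem3p1 (k p : R) (hk : 1 <= k) (hp : p <> 0) :
  (forall x : R, 0 < x < PI / 2 -> lhs k p x > 1) <->
  (p > 0 \/ p <= - ((ln (k + 2) - ln 2) / (k * (ln PI - ln 2)))).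
Proof.
  fold (crit k). split.
  - intros h. destruct (Rdichotomy _ _ hp) as [hp0|hp0]; [right | now left].
    apply Rnot_lt_le. intro hc.
    destruct (exists_violation k (- p)) as [x [hx hv]]; [lra | lra |].
    pose proof (proj1 (lhs_gt_1 k p x ltac:(lra) hx) (h x hx)). lra.
  - intros [h|h] x hx.
    + apply lhs_gt_1_of_pos; lra.
    + apply lhs_gt_1; [lra | exact hx |]. apply crit_le; lra.
Qed.
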